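(* Let $p,q\in\mathbb{R}$ with $p\ge 0$, $q\ge 0$, let $\lambda,\rho\in\mathbb{C}$ with $\Re(\rho)>-\frac12$, $\Re(\rho+\lambda)>-\frac12$ and $\Re(\rho-\lambda)>-\frac12$, and let $z\in\mathbb{C}\setminus(-\infty,0]$. Let $M_{p,q;\lambda,\rho}(z)$ be the $(p,q)$-Whittaker function and let $B$ be the classical beta function. Then the following five integral representations hold: (1) $$M_{p,q;\lambda,\rho}(z)=\frac{z^{\rho+\frac12}\exp(-\frac z2)}{B(\rho-\lambda+\frac12,\rho+\lambda+\frac12)}\int_0^1 t^{\rho-\lambda-\frac12}(1-t)^{\rho+\lambda-\frac12}\exp\Big(zt-\frac pt-\frac q{1-t}\Big)\,dt;$$ (2) $$M_{p,q;\lambda,\rho}(z)=\frac{z^{\rho+\frac12}\exp(\frac z2)}{B(\rho-\lambda+\frac12,\rho+\lambda+\frac12)}\int_0^1 u^{\rho+\lambda-\frac12}(1-u)^{\rho-\lambda-\frac12}\exp\Big(-zu-\frac p{1-u}-\frac qu\Big)\,du;$$ (3) for all $a,b\in\mathbb{R}$ with $b>a$, $$M_{p,q;\lambda,\rho}(z)=\frac{(b-a)^{-2\rho}z^{\rho+\frac12}\exp(-\frac z2)}{B(\rho-\lambda+\frac12,\rho+\lambda+\frac12)}\int_a^b (u-a)^{\rho-\lambda-\frac12}(b-u)^{\rho+\lambda-\frac12}\exp\Big[\frac{z(u-a)}{b-a}-\frac{p(b-a)}{u-a}-\frac{q(b-a)}{b-u}\Big]\,du;$$ (4) $$M_{p,q;\lambda,\rho}(z)=\frac{z^{\rho+\frac12}\exp(-\frac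 z2)}{B(\rho-\lambda+\frac12,\rho+\lambda+\frac12)}\int_0^\infty u^{\rho-\lambda-\frac12}(1+u)^{-(2\rho+1)}\exp\Big[\frac{zu}{1+u}-\frac{p(1+u)}{u}-q(1+u)\Big]\,du;$$ (5) $$M_{p,q;\lambda,\rho}(z)=\frac{2^{-2\rho}z^{\rho+\frac12}\exp(-\frac z2)}{B(\rho-\lambda+\frac12,\rho+\lambda+\frac12)}\int_{-1}^1 (1+u)^{\rho-\lambda-\frac12}(1-u)^{\rho+\lambda-\frac12}\exp\Big[\frac{z(u+1)}2-\frac{2p}{1+u}-\frac{2q}{1-u}\Big]\,du.$$
   Context: $B(x,y)=\int_0^1 t^{x-1}(1-t)^{y-1}\,dt=\Gamma(x)\Gamma(y)/\Gamma(x+y)$ is the classical beta function ($\Re x,\Re y>0$). For real $p,q\ge0$ and $\Re x,\Re y>0$, the extended beta function is $$B_{p,q}(x,y)=\int_0^1 t^{x-1}(1-t)^{y-1}\exp\Big[-\frac pt-\frac q{1-t}\Big]\,dt.$$ The $(p,q)$-confluent hypergeometric function is, for $p,q\ge0$, $\Re(c)>\Re(b)>0$ and $z\in\mathbb{C}$, $$\Phi_{p,q}(b;c;z)=\sum_{n=0}^\infty\frac{B_{p,q}(b+n,c-b)}{B(b,c-b)}\frac{z^n}{n!}.$$ The $(p,q)$-Whittaker function is $$M_{p,q;\lambda,\rho}(z)=z^{\rho+\frac12}\exp\Big(-\frac z2\Big)\,\Phi_{p,q}\Big(\rho-\lambda+\frac12;2\rho+1;z\Big),$$ defined for $p,q\ge0$,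 $\Re(\rho)>-\frac12$, $\Re(\rho\pm\lambda)>-\frac12$, $z\in\mathbb{C}\setminus(-\infty,0]$, with the principal branch of $z^{\rho+\frac12}$. *)

(* Defs.v *)
From Stdlib Require Import Reals Factorial.
From Coquelicot Require Import Coquelicot.
Open Scope R_scope.

Definition Cexp (z : C) : C :=
  (exp (Re z) * cos (Im z), exp (Re z) * sin (Im z)).

(* Principal argument, with values in (-PI, PI]; the value at 0 is
   meaningless. *)
Definition Carg (z : C) : R :=
  if Rle_dec 0 (Im z) then acos (Re z / Cmod z) else - acos (Re z / Cmod z).

Definition Clog (z : C) : C := (ln (Cmod z), Carg z).

(* Principal branch of z^w, for z <> 0; positive real bases are handled by
   the coercion from R to C, where Carg vanishes. *)
Definition Cpower (z w : C) : C := Cexp (w * Clog z)%C.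

(* Total integral and sum of C-valued functions and sequences.  They are
   meaningful only when the integral, resp. the series, converges.  The
   integral is the improper Riemann integral along the filters Fa, Fb, and C is
   there seen as a normed module over R (the canonical structure of C would be
   the one over C itself). *)
Definition ex_CInt_gen (f : R -> C) (Fa Fb : (R -> Prop) -> Prop) : Prop :=
  @ex_RInt_gen C_R_NormedModule f Fa Fb.

Definition CInt_gen (f : R -> C) (Fa Fb : (R -> Prop) -> Prop) : C :=
  @RInt_gen C_R_CompleteNormedModule f Fa Fb.

Definition CSeries (a : nat -> C) : C :=
  @iota C_CompleteNormedModule (@is_series C_AbsRing C_NormedModule a).

(* For 0 < Re x and 0 < Re y. *)
Definition Beta (x y : C) : C :=
  CInt_gen (fun t : R => Cpower t (x - 1) * Cpower (1 - t) (y - 1))%C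
    (at_right 0) (at_left 1).

(* For 0 <= p, 0 <= q, 0 < Re x and 0 < Re y. *)
Definition Beta_ext (p q : R) (x y : C) : C :=
  CInt_gen (fun t : R =>
      Cpower t (x - 1) * Cpower (1 - t) (y - 1)
        * Cexp (- (p / t) - q / (1 - t)))%C
    (at_right 0) (at_left 1).

(* For 0 <= p, 0 <= q and 0 < Re b < Re c. *)
Definition Phi (p q : R) (b c z : C) : C :=
  CSeries (fun n : nat =>
    Beta_ext p q (b + INR n) (c - b) / Beta b (c - b)
      * (Cpow z n / INR (fact n)))%C.

(* For 0 <= p, 0 <= q, -1/2 < Re rho, -1/2 < Re (rho + lambda),
   -1/2 < Re (rho - lambda) and z outside (-oo, 0]. *)
Definition Whittaker (p q : R) (lambda rho z : C) : C :=
  (Cpower z (rho + 1 / 2) * Cexp (- (z / 2))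
     * Phi p q (rho - lambda + 1 / 2) (2 * rho + 1) z)%C.

(* Main.v *)
(* Expanding exp(zt) in its power series under the integral (1) turns it into the
   series defining Phi: the n-th term produces t^n, which shifts the first
   parameter of the extended beta function by n.  The exchange is justified by
   |exp(tz) - sum_{k<n} (tz)^k / k!| <= exp|z| |z|^n / n! for 0 <= t <= 1, together
   with an integrable majorant of the beta integrand.  The other four
   representations follow from (1) by t = 1 - u, t = (u - a) / (b - a),
   t = u / (1 + u) and t = (u + 1) / 2. *)

Require Import Defs.
From Stdlib Require Import Reals Factorial Lra Lia.
From Coquelicot Require Import Coquelicot.
Open Scope R_scope.

(** The integrals are improper at both ends, and since p = q = 0 is allowed, the factors exp(-p/t)
    and exp(-q/(1-t)) cannot be relied on for convergence. The majorant is therefore one for the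
    plain beta integrand, chosen as a sum of two pure powers because such a sum has an explicit
    primitive: convergence follows from the Cauchy criterion for that primitive, and its limits at 0
    and 1 give the constant in the exchange of sum and integral. The factor exp|z| in the remainder
    bound comes from order zero, |exp(tz)| <= exp|z|; each further order is one integration along
    the segment from 0 to z. With x = rho - lambda + 1/2 and y = rho + lambda + 1/2, so x + y = 2
    rho + 1, the integrand is merged into a single exponential, and each change of variable reduces
    to an identity between exponents. *)

(** * C as a real normed space *)

Lemma exp_le_mono (u v : R) : u <= v -> exp u <= exp v.
Proof. intros [H| ->]; [left; now apply exp_increasing|right; reflexivity]. Qed.

(** The convexity hypothesis says that [D] is an interval. It lets (0, 1), (a, b) and the half-line
    be treated alike, with [u] and [v] in either order. *)
Lemma between_convex (D : R -> Prop) (u v t : R) :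
  (forall x y s, D x -> D y -> x <= s <= y -> D s) ->
  D u -> D v -> Rmin u v <= t <= Rmax u v -> D t.
Proof.
  intros HD Hu Hv; unfold Rmin, Rmax; destruct (Rle_dec u v); intro;
    [now apply (HD u v)|now apply (HD v u)].
Qed.

Lemma RtoC_neq_0 (r : R) : r <> 0 -> RtoC r <> 0.
Proof. intros H E; apply H; now apply RtoC_inj in E. Qed.

(** On the basis (1, 0), (0, 1), differentiating a C-valued function reduces by linearity to
    differentiating its two real components. *)
Lemma pair_scal (u v : R) :
  (u, v) = @plus C_R_NormedModule (@scal _ C_R_NormedModule u (1, 0)) (@scal _ C_R_NormedModule v (0, 1)).
Proof.
  unfold plus, scal; simpl; unfold prod_plus, prod_scal, scal; simpl.
  unfold mult, plus; simpl; f_equal; ring.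
Qed.

Lemma is_derive_pair (f g : R -> R) (x lf lg : R) :
  is_derive f x lf -> is_derive g x lg ->
  @is_derive _ C_R_NormedModule (fun t => (f t, g t)) x (lf, lg).
Proof.
  intros Hf Hg.
  apply @is_derive_ext with
    (fun t => @plus C_R_NormedModule (@scal _ C_R_NormedModule (f t) (1, 0))
                (@scal _ C_R_NormedModule (g t) (0, 1))).
  { intro t; symmetry; apply pair_scal. }
  rewrite (pair_scal lf lg).
  apply @is_derive_plus; now apply @is_derive_scal_l.
Qed.

Lemma continuous_pair (f g : R -> R) (x : R) :
  continuous f x -> continuous g x -> @continuous _ C_R_NormedModule (fun t => (f t, g t)) x.
Proof.
  intros Hf Hg.
  apply (continuous_comp_2 f g (fun u v => (u, v))); auto.
  apply continuous_ext with (fun u => u); [now intros []|apply continuous_id].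
Qed.

(** The norm of a product of normed modules is the Euclidean one, not the maximum. *)
Lemma norm_C_R (w : C_R_NormedModule) : norm w = Cmod w.
Proof.
  unfold norm; simpl. unfold prod_norm, Cmod, norm; simpl. unfold abs; simpl.
  f_equal. f_equal; rewrite !Rmult_1_r, <- Rabs_mult; apply Rabs_pos_eq; nra.
Qed.

Lemma scal_C_R (k : R) (w : C) : @scal _ C_R_NormedModule k w = (k * w)%C.
Proof.
  unfold scal; simpl; unfold prod_scal, scal, Cmult; simpl; unfold mult; simpl.
  f_equal; ring.
Qed.

(** Proved for C as a module over itself; the uniform structure is that of the real module, so it
    serves both for integrals and for series. *)
Lemma continuous_Cmult_l (c l : C) : @continuous C_UniformSpace C_UniformSpace (Cmult c) l.
Proof. exact (@filterlim_scal_r _ C_NormedModule c l). Qed.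

(** * Complex exponential and powers of positive reals *)

Lemma Cexp_plus (u v : C) : Cexp (u + v) = (Cexp u * Cexp v)%C.
Proof.
  unfold Cexp, Cmult, Cplus, Re, Im; simpl.
  rewrite exp_plus, cos_plus, sin_plus; f_equal; ring.
Qed.

Lemma Cmod_Cexp (w : C) : Cmod (Cexp w) = exp (Re w).
Proof.
  unfold Cmod, Cexp; simpl.
  replace (_ + _) with (exp (Re w) * exp (Re w)).
  - apply sqrt_square, Rlt_le, exp_pos.
  - pose proof (sin2_cos2 (Im w)) as H; unfold Rsqr in H.
    transitivity (exp (Re w) * exp (Re w)
      * (sin (Im w) * sin (Im w) + cos (Im w) * cos (Im w))); [rewrite H|]; ring.
Qed.

Lemma Cexp_RtoC (x : R) : Cexp x = exp x.
Proof.
  unfold Cexp, RtoC; simpl; rewrite cos_0, sin_0; f_equal; ring.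
Qed.

Lemma RtoC_Cexp_ln (r : R) : 0 < r -> RtoC r = Cexp (ln r).
Proof. intro H; now rewrite Cexp_RtoC, exp_ln. Qed.

(** On the positive axis the principal argument is acos 1 = 0, so only the real logarithm
    remains. *)
Lemma Cpower_pos (t : R) (w : C) : 0 < t -> Cpower t w = Cexp (w * ln t).
Proof.
  intro Ht; unfold Cpower, Clog, Carg.
  rewrite Cmod_R, (Rabs_pos_eq t) by lra.
  unfold RtoC at 1 2 3; simpl.
  destruct (Rle_dec 0 0) as [_|]; [|lra].
  replace (t / t) with 1 by (field; lra).
  now rewrite acos_1.
Qed.

(** * Taylor remainder of the exponential *)

(** Indexed by the number of terms rather than the degree: differentiation lowers the index by one,
    and inductions start from the zero polynomial. *)
Fixpoint exp_poly (n : nat) (w : C) : C :=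
  match n with
  | O => 0
  | S m => exp_poly m w + w ^ m / INR (fact m)
  end%C.

Lemma exp_poly_0 (n : nat) : exp_poly (S n) 0 = 1.
Proof.
  induction n as [|n IH]; [simpl; field|].
  change (exp_poly (S n) 0 + 0 ^ S n / INR (fact (S n)) = 1)%C.
  rewrite IH, Cpow_S. unfold Cdiv; ring.
Qed.

Lemma Cfact_neq_0 (n : nat) : RtoC (INR (fact n)) <> 0.
Proof. apply RtoC_neq_0, INR_fact_neq_0. Qed.

(** The derivative is taken along the segment from 0 to [w], in a real variable, so that the
    fundamental theorem of calculus for C-valued functions of a real variable applies. *)
Lemma is_derive_Cexp_line (w : C) (s : R) :
  @is_derive _ C_R_NormedModule (fun u : R => Cexp (u * w)) s (w * Cexp (s * w))%C.
Proof.
  destruct w as [x y].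
  apply @is_derive_ext with (fun u => (exp (u * x) * cos (u * y), exp (u * x) * sin (u * y))).
  { intro u; unfold Cexp, Cmult, RtoC, Re, Im; simpl.
    replace (u * x - 0 * y) with (u * x) by ring.
    now replace (u * y + 0 * x) with (u * y) by ring. }
  unfold Cexp, Cmult, RtoC, Re, Im; simpl.
  replace (s * x - 0 * y) with (s * x) by ring.
  replace (s * y + 0 * x) with (s * y) by ring.
  apply is_derive_pair; auto_derive; auto; ring.
Qed.

Lemma is_derive_exp_poly_line (n : nat) (w : C) (s : R) :
  @is_derive _ C_R_NormedModule (fun u : R => exp_poly (S n) (u * w)) s
    (w * exp_poly n (s * w))%C.
Proof.
  induction n as [|n IH].
  - apply (@is_derive_ext _ C_R_NormedModule (fun _ => RtoC 1)).
    { intro; simpl. field. }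
    simpl. rewrite Cmult_0_r. apply @is_derive_const.
  - apply @is_derive_ext with (fun u : R => @plus C_R_NormedModule (exp_poly (S n) (u * w)%C)
      (@scal _ C_R_NormedModule (u ^ (S n)) (w ^ S n / INR (fact (S n)))%C)).
    { intro u; rewrite scal_C_R, RtoC_pow. unfold plus; simpl plus.
      change (exp_poly (S n) (u * w) + u ^ S n * (w ^ S n / INR (fact (S n)))
              = exp_poly (S n) (u * w) + (u * w) ^ S n / INR (fact (S n)))%C.
      unfold Cdiv; now rewrite Cpow_mult_l, Cmult_assoc. }
    replace (w * exp_poly (S n) (s * w))%C with
      (@plus C_R_NormedModule (w * exp_poly n (s * w))%C
        (@scal _ C_R_NormedModule (INR (S n) * s ^ n) (w ^ S n / INR (fact (S n)))%C)).
    + apply @is_derive_plus; [exact IH|].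
      apply @is_derive_scal_l. auto_derive; auto. apply Rmult_1_l.
    + rewrite scal_C_R.
      change (w * exp_poly n (s * w) + (INR (S n) * s ^ n)%R * (w ^ S n / INR (fact (S n)))
       = w * (exp_poly n (s * w) + (s * w) ^ n / INR (fact n)))%C.
      rewrite Cpow_mult_l, RtoC_mult, RtoC_pow, fact_simpl, mult_INR, RtoC_mult, Cpow_S.
      field; split; [apply Cfact_neq_0|].
      apply RtoC_neq_0, not_0_INR; discriminate.
Qed.

(** Integrating the bound of order [n] from 0 to [s] produces the one of order [S n]; the factor
    [s ^ n] is kept because its integration supplies the new factor 1 / (n + 1) of the factorial. *)
Lemma Cexp_remainder (n : nat) (w : C) (s : R) : 0 <= s <= 1 ->
  Cmod (Cexp (s * w) - exp_poly n (s * w))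
    <= exp (Cmod w) * Cmod w ^ n * s ^ n / INR (fact n).
Proof.
  revert s; induction n as [|n IH]; intros s Hs.
  - simpl. replace (Cexp (s * w) - 0)%C with (Cexp (s * w)) by ring.
    rewrite Cmod_Cexp.
    replace (_ / 1) with (exp (Cmod w)) by field.
    assert (H : Re (s * w) <= Cmod w).
    { replace (Re (s * w)) with (s * Re w) by (unfold Re, Cmult, RtoC; simpl; ring).
      pose proof (re_le_Cmod w); pose proof (Rle_abs (Re w)); pose proof (Cmod_ge_0 w); nra. }
    destruct H as [H| ->]; [left; now apply exp_increasing|right; reflexivity].
  - (* The remainder [D n] satisfies [(D (S n))' = w D n] and [D (S n) 0 = 0]. *)
    set (D := fun (m : nat) (u : R) =>
      (@minus C_R_NormedModule (Cexp (RtoC u * w)) (exp_poly m (RtoC u * w)%C) : C)).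
    assert (HD : forall u, @is_derive _ C_R_NormedModule (D (S n)) u (w * D n u)%C).
    { intro u. replace (w * D n u)%C with
        (@minus C_R_NormedModule (w * Cexp (u * w))%C (w * exp_poly n (u * w))%C).
      - apply @is_derive_minus; [apply is_derive_Cexp_line|apply is_derive_exp_poly_line].
      - change (w * Cexp (u * w) - w * exp_poly n (u * w)
                = w * (Cexp (u * w) - exp_poly n (u * w)))%C; ring. }
    assert (HDc : forall u, @continuous _ C_R_NormedModule (fun u => (w * D n u)%C) u).
    { intro u. apply (@continuous_comp R_UniformSpace C_UniformSpace C_UniformSpace (D n)).
      2: apply continuous_Cmult_l.
      apply (continuous_minus (V := C_R_NormedModule)).
      - apply (@ex_derive_continuous _ C_R_NormedModule).
        eexists; apply is_derive_Cexp_line.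
      (* The derivative lemma speaks of a successor index only; [exp_poly 0] is constant. *)
      - destruct n as [|n].
        + apply @continuous_const.
        + apply (@ex_derive_continuous _ C_R_NormedModule).
          eexists; apply is_derive_exp_poly_line. }
    assert (D0 : D (S n) 0 = RtoC 0).
    { change (Cexp (0 * w) - exp_poly (S n) (0 * w) = 0)%C.
      rewrite Cmult_0_l, Cexp_RtoC, exp_0, exp_poly_0. ring. }
    assert (HI := @is_RInt_derive C_R_CompleteNormedModule (D (S n)) _ 0 s
      (fun u _ => HD u) (fun u _ => HDc u)).
    rewrite D0 in HI.
    change (@is_RInt C_R_NormedModule (fun u => w * D n u)%C 0 s (D (S n) s - 0)%C) in HI.
    replace (D (S n) s - 0)%C with (D (S n) s) in HI by ring.
    assert (HG : is_RInt (fun u => exp (Cmod w) * Cmod w ^ (S n) * u ^ n / INR (fact n)) 0 s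
       (exp (Cmod w) * Cmod w ^ S n * s ^ S n / INR (fact (S n)))).
    { set (k := exp (Cmod w) * Cmod w ^ S n).
      replace (k * s ^ S n / INR (fact (S n))) with
        (minus (k * s ^ S n / INR (fact (S n))) (k * 0 ^ S n / INR (fact (S n))))
        by (unfold minus, plus, opp; simpl; unfold Rdiv; ring).
      apply (is_RInt_derive (fun u => k * u ^ S n / INR (fact (S n)))).
      - intros u _. auto_derive; auto.
        change (k * (1 * (INR (S n) * u ^ n)) * / INR (fact (S n)) = k * u ^ n / INR (fact n)).
        rewrite fact_simpl, mult_INR.
        field; split; [apply INR_fact_neq_0|apply not_0_INR; discriminate].
      - intros u _. apply (@ex_derive_continuous _ R_NormedModule). auto_derive; auto. }
    change (Cmod (D (S n) s) <= exp (Cmod w) * Cmod w ^ S n * s ^ S n / INR (fact (S n))).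
    rewrite <- norm_C_R.
    eapply (@norm_RInt_le C_R_NormedModule); [apply (proj1 Hs)| |exact HI|exact HG].
    intros u Hu. rewrite norm_C_R, Cmod_mult.
    specialize (IH u ltac:(lra)).
    change (Cmod (D n u) <= exp (Cmod w) * Cmod w ^ n * u ^ n / INR (fact n)) in IH.
    apply Rle_trans with (Cmod w * (exp (Cmod w) * Cmod w ^ n * u ^ n / INR (fact n))).
    + apply Rmult_le_compat_l; [apply Cmod_ge_0|exact IH].
    + right; simpl; field; apply INR_fact_neq_0.
Qed.

(** * Improper integrals: complex factors, domination, substitution, primitives *)

(** The module has real scalars, so a complex factor is not an instance of [scal]: it is pulled out
    of each Riemann sum and passes to the limit by continuity. *)
Lemma is_RInt_Cmult_l (c : C) (f : R -> C) (a b : R) (l : C) :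
  @is_RInt C_R_NormedModule f a b l ->
  @is_RInt C_R_NormedModule (fun t => c * f t)%C a b (c * l)%C.
Proof.
  intro H; unfold is_RInt.
  assert (HR : forall ptd, @Riemann_sum C_R_NormedModule (fun t => c * f t)%C ptd
     = (c * @Riemann_sum C_R_NormedModule f ptd)%C).
  { intro ptd; apply (SF_cons_ind (fun ptd => @Riemann_sum C_R_NormedModule (fun t => c * f t)%C ptd
     = (c * @Riemann_sum C_R_NormedModule f ptd)%C)); clear.
    - intros x; unfold Riemann_sum; simpl. symmetry; apply Cmult_0_r.
    - intros h s IH. rewrite !Riemann_sum_cons, IH, !scal_C_R.
      change ((SF_h s - fst h)%R * (c * f (snd h)) + c * @Riemann_sum C_R_NormedModule f s
        = c * ((SF_h s - fst h)%R * f (snd h) + @Riemann_sum C_R_NormedModule f s))%C.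
      ring. }
  apply filterlim_ext with (fun ptd =>
    (c * @scal _ C_R_NormedModule (sign (b - a)) (Riemann_sum f ptd))%C).
  { intro ptd; rewrite HR, !scal_C_R, !Cmult_assoc; f_equal; apply Cmult_comm. }
  eapply filterlim_comp; [exact H|apply continuous_Cmult_l].
Qed.

Lemma is_RInt_gen_Cmult_l (Fa Fb : (R -> Prop) -> Prop) {FFa : Filter Fa} {FFb : Filter Fb}
    (c : C) (f : R -> C) (l : C) :
  @is_RInt_gen C_R_NormedModule f Fa Fb l ->
  @is_RInt_gen C_R_NormedModule (fun t => c * f t)%C Fa Fb (c * l)%C.
Proof.
  intros H P HP.
  specialize (H _ (continuous_Cmult_l c l P HP)).
  unfold filtermapi in *; revert H; apply filter_imp; intros ab (y & Hy & HPy).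
  exists (c * y)%C; split; [now apply is_RInt_Cmult_l|exact HPy].
Qed.

(* The difference of two integrals of [f] telescopes into its integrals over two
   short intervals near the ends, where the oscillation of [G] bounds them. *)
Lemma ex_RInt_gen_dominated (V : CompleteNormedModule R_AbsRing)
    (Fa Fb : (R -> Prop) -> Prop) {FFa : ProperFilter Fa} {FFb : ProperFilter Fb}
    (D : R -> Prop) (f : R -> V) (G g : R -> R) (la lb : R) :
  (forall x y t, D x -> D y -> x <= t <= y -> D t) ->
  Fa D -> Fb D ->
  (forall t, D t -> continuous f t) ->
  (forall t, D t -> is_derive G t (g t)) ->
  (forall t, D t -> continuous g t) ->
  (forall t, D t -> norm (f t) <= g t) ->
  filterlim G Fa (locally la) -> filterlim G Fb (locally lb) ->
  ex_RInt_gen f Fa Fb.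
Proof.
  intros HD HFa HFb Hf HG Hg Hfg Hla Hlb.
  assert (Hex : forall x y, D x -> D y -> ex_RInt f x y).
  { intros x y Hx Hy. apply ex_RInt_continuous; intros t Ht; apply Hf.
    now apply (between_convex D x y). }
  assert (Hle : forall x y, D x -> D y -> x <= y -> norm (RInt f x y) <= G y - G x).
  { intros x y Hx Hy Hxy.
    apply (norm_RInt_le f g x y _ (minus (G y) (G x))); auto.
    - intros t Ht; apply Hfg; now apply (HD x y).
    - now apply RInt_correct, Hex.
    - apply (@is_RInt_derive R_CompleteNormedModule); rewrite Rmin_left, Rmax_right by auto; intros t Ht;
        [apply HG|apply Hg]; now apply (HD x y). }
  (* In the Cauchy estimate the two left ends come in either order, and so do the two right ends. *)
  assert (Hle' : forall x y, D x -> D y -> norm (RInt f x y) <= Rabs (G y - G x)).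
  { intros x y Hx Hy. destruct (Rle_dec x y) as [Hxy|Hxy].
    - eapply Rle_trans; [now apply Hle|apply Rle_abs].
    - rewrite <- opp_RInt_swap by now apply Hex.
      rewrite Rabs_minus_sym.
      eapply Rle_trans; [right; apply (@norm_opp _ V)|].
      eapply Rle_trans; [apply Hle; auto; lra|apply Rle_abs]. }
  destruct (proj1 (@filterlim_locally_cauchy _ V (filter_prod Fa Fb) filter_prod_proper
    (fun ab => RInt f (fst ab) (snd ab)))) as [l Hl].
  - intro eps.
    (* Four values of [G] lie within eps / 4 of their limits, so each end contributes an oscillation
       below eps / 2. *)
    assert (He : 0 < eps / 4) by (pose proof (cond_pos eps); lra).
    pose proof (proj1 (filterlim_locally _ _) Hla (mkposreal _ He)) as Ha.
    pose proof (proj1 (filterlim_locally _ _) Hlb (mkposreal _ He)) as Hb.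
    exists (fun ab => (D (fst ab) /\ ball la (eps / 4) (G (fst ab)))
             /\ (D (snd ab) /\ ball lb (eps / 4) (G (snd ab)))).
    split.
    + apply (Filter_prod Fa Fb _ _ _ (filter_and _ _ HFa Ha) (filter_and _ _ HFb Hb)).
      simpl; tauto.
    + intros [u1 u2] [v1 v2] [[U1 U1'] [U2 U2']] [[V1 V1'] [V2 V2']]; simpl in *.
      apply (@norm_compat1 _ V).
      assert (E : @minus V (RInt f v1 v2) (RInt f u1 u2) = @plus V (RInt f v1 u1) (RInt f u2 v2)).
      { rewrite <- (RInt_Chasles f v1 u1 v2), <- (RInt_Chasles f u1 u2 v2) by now apply Hex.
        unfold minus. rewrite <- plus_assoc. f_equal.
        rewrite (plus_comm (RInt f u1 u2)), <- plus_assoc.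
        rewrite (@plus_opp_r V); apply (@plus_zero_r V). }
      change (@norm _ V (@minus V (RInt f v1 v2) (RInt f u1 u2)) < eps); rewrite E.
      eapply Rle_lt_trans; [apply (@norm_triangle _ V)|].
      pose proof (Hle' _ _ V1 U1) as H1; pose proof (Hle' _ _ U2 V2) as H2.
      unfold ball, AbsRing_ball in U1', U2', V1', V2'; simpl in *.
      unfold AbsRing_ball, abs, minus, plus, opp in U1', U2', V1', V2'; simpl in *.
      apply Rabs_def2 in U1'; apply Rabs_def2 in U2'; apply Rabs_def2 in V1';
      apply Rabs_def2 in V2'.
      assert (Rabs (G u1 - G v1) < eps / 2) by (apply Rabs_def1; lra).
      assert (Rabs (G v2 - G u2) < eps / 2) by (apply Rabs_def1; lra).
      lra.
  - exists l. intros P HP. specialize (Hl P HP).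
    assert (HDD : filter_prod Fa Fb (fun ab => D (fst ab) /\ D (snd ab)))
      by (apply (Filter_prod Fa Fb _ _ _ HFa HFb); simpl; tauto).
    generalize (filter_and (fun ab => P (RInt f (fst ab) (snd ab))) _ Hl HDD).
    unfold filtermapi; apply filter_imp.
    intros [x y] [HPxy [Hx Hy]]; simpl in *.
    exists (RInt f x y); split; [now apply RInt_correct, Hex|exact HPxy].
Qed.

(** The substitution is made in proper integrals inside [D], and [phi] transports the filters, so a
    singular or infinite end is only approached. No sign is imposed on [dphi], which admits t = 1 -
    u. *)
Lemma is_RInt_gen_comp (V : CompleteNormedModule R_AbsRing)
    (Fa Fb Fa' Fb' : (R -> Prop) -> Prop) {FFa : Filter Fa} {FFb : Filter Fb}
    (D : R -> Prop) (f : R -> V) (phi dphi : R -> R) (l : V) :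
  (forall x y t, D x -> D y -> x <= t <= y -> D t) ->
  Fa D -> Fb D ->
  (forall t, D t -> continuous f (phi t)) ->
  (forall t, D t -> is_derive phi t (dphi t)) ->
  (forall t, D t -> continuous dphi t) ->
  filterlim phi Fa Fa' -> filterlim phi Fb Fb' ->
  is_RInt_gen f Fa' Fb' l ->
  is_RInt_gen (fun t => scal (dphi t) (f (phi t))) Fa Fb l.
Proof.
  intros HD HFa HFb Hf Hphi Hdphi Ha Hb H P HP.
  destruct (H P HP) as [Q S HQ HS HQS].
  apply (Filter_prod Fa Fb _ _ _ 
    (filter_and D (fun t => Q (phi t)) HFa (Ha Q HQ))
    (filter_and D (fun t => S (phi t)) HFb (Hb S HS))).
  intros x y [Dx Qx] [Dy Sy].
  destruct (HQS _ _ Qx Sy) as (v & Hv & HPv); simpl in *.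
  exists v; split; [|exact HPv].
  rewrite <- (is_RInt_unique _ _ _ _ Hv).
  assert (HDt : forall t, Rmin x y <= t <= Rmax x y -> D t).
  { intros t Ht; now apply (between_convex D x y). }
  apply is_RInt_comp; intros t Ht; [|split]; auto.
Qed.

(** The primitive needs a derivative only inside [D] and limits at the ends, because the majorant
    blows up at 0 or 1 when an exponent is negative. *)
Lemma is_RInt_gen_derive_on (Fa Fb : (R -> Prop) -> Prop) {FFa : Filter Fa} {FFb : Filter Fb}
    (D : R -> Prop) (G g : R -> R) (la lb : R) :
  (forall x y t, D x -> D y -> x <= t <= y -> D t) ->
  Fa D -> Fb D ->
  (forall t, D t -> is_derive G t (g t)) ->
  (forall t, D t -> continuous g t) ->
  filterlim G Fa (locally la) -> filterlim G Fb (locally lb) ->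
  is_RInt_gen g Fa Fb (lb - la).
Proof.
  intros HD HFa HFb HG Hg Hla Hlb P HP.
  assert (Hlim : filterlim (fun ab => plus (G (snd ab)) (opp (G (fst ab)))) (filter_prod Fa Fb)
                   (locally (plus lb (opp la)))).
  { apply (filterlim_comp_2 (fun ab => G (snd ab)) (fun ab => opp (G (fst ab))) plus
             (G := locally lb) (H := locally (opp la))).
    - eapply filterlim_comp; [apply filterlim_snd|exact Hlb].
    - eapply filterlim_comp; [|apply (filterlim_opp la)].
      eapply filterlim_comp; [apply filterlim_fst|exact Hla].
    - apply (filterlim_plus lb (opp la)). }
  assert (HDD : filter_prod Fa Fb (fun ab => D (fst ab) /\ D (snd ab)))
    by (apply (Filter_prod Fa Fb _ _ _ HFa HFb); simpl; tauto).
  generalize (filter_and (fun ab => P (G (snd ab) - G (fst ab))) _ (Hlim P HP) HDD).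
  unfold filtermapi; apply filter_imp.
  intros [x y] [HPxy [Hx Hy]]; simpl in *.
  exists (G y - G x); split; [|exact HPxy].
  assert (HDt : forall t, Rmin x y <= t <= Rmax x y -> D t).
  { intros t Ht; now apply (between_convex D x y). }
  apply (@is_RInt_derive R_CompleteNormedModule G g x y); auto.
Qed.

(** * One-sided limits and the majorant of the beta integrand *)

Lemma at_right_interval (a b : R) : a < b -> at_right a (fun t => a < t < b).
Proof.
  intro Hab. assert (H : 0 < b - a) by lra.
  exists (mkposreal _ H); intros t Ht Hta.
  change (Rabs (t - a) < b - a) in Ht; apply Rabs_def2 in Ht; lra.
Qed.

Lemma at_left_interval (a b : R) : a < b -> at_left b (fun t => a < t < b).
Proof.
  intro Hab. assert (H : 0 < b - a) by lra.
  exists (mkposreal _ H); intros t Ht Htb.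
  change (Rabs (t - b) < b - a) in Ht; apply Rabs_def2 in Ht; lra.
Qed.

Lemma filterlim_within_continuous (D E : R -> Prop) (phi : R -> R) (a : R) :
  continuous phi a -> (forall t, D t -> E (phi t)) ->
  filterlim phi (within D (locally a)) (within E (locally (phi a))).
Proof.
  intros Hphi HDE P HP.
  generalize (Hphi _ HP); unfold filtermap, within; apply filter_imp; auto.
Qed.

Lemma filterlim_one_minus_right : filterlim (fun t => 1 - t) (at_left 1) (at_right 0).
Proof.
  pose proof (filterlim_within_continuous (fun t => t < 1) (fun t => 0 < t) (fun t => 1 - t) 1) as H.
  cbv beta in H; replace (1 - 1) with 0 in H by ring.
  apply H; [|intros; lra].
  apply (@ex_derive_continuous _ R_NormedModule); auto_derive; auto.
Qed.

Lemma filterlim_one_minus_left : filterlim (fun t => 1 - t) (at_right 0) (at_left 1).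
Proof.
  pose proof (filterlim_within_continuous (fun t => 0 < t) (fun t => t < 1) (fun t => 1 - t) 0) as H.
  cbv beta in H; replace (1 - 0) with 1 in H by ring.
  apply H; [|intros; lra].
  apply (@ex_derive_continuous _ R_NormedModule); auto_derive; auto.
Qed.

Lemma filterlim_rpower_0 (b : R) : 0 < b ->
  filterlim (fun t => exp (b * ln t)) (at_right 0) (locally 0).
Proof.
  intro Hb. eapply filterlim_comp; [|apply is_lim_exp_m].
  eapply filterlim_comp; [apply is_lim_ln_0|].
  intros P [M HM]; exists (M / b); intros u Hu; apply HM.
  apply Rmult_lt_reg_r with (/ b); [now apply Rinv_0_lt_compat|].
  now replace (b * u * / b) with u by (field; lra).
Qed.

(** This is t^(b-1) + (1-t)^(c-1), in a form that [auto_derive] handles. *)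
Definition beta_majorant (b c t : R) : R :=
  exp ((b - 1) * ln t) + exp ((c - 1) * ln (1 - t)).

Lemma beta_majorant_integrable (b c k : R) : 0 < b -> 0 < c ->
  exists G la lb,
    (forall t, 0 < t < 1 -> is_derive G t (k * beta_majorant b c t)) /\
    (forall t, 0 < t < 1 -> continuous (fun t => k * beta_majorant b c t) t) /\
    filterlim G (at_right 0) (locally la) /\ filterlim G (at_left 1) (locally lb).
Proof.
  intros Hb Hc.
  set (H := fun u v : R => plus (scal (k / b) u) (opp (scal (k / c) v))).
  assert (HH : forall F (f1 f2 : R -> R) l1 l2, Filter F ->
    filterlim f1 F (locally l1) -> filterlim f2 F (locally l2) ->
    filterlim (fun t => H (f1 t) (f2 t)) F (locally (H l1 l2))).
  { intros F f1 f2 l1 l2 FF H1 H2. unfold H.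
    apply (filterlim_comp_2 (fun t => scal (k / b) (f1 t)) (fun t => opp (scal (k / c) (f2 t))) plus
       (G := locally (scal (k / b) l1)) (H := locally (opp (scal (k / c) l2)))).
    - eapply filterlim_comp; [exact H1|apply (@filterlim_scal_r _ R_NormedModule (k / b) l1)].
    - eapply filterlim_comp; [|apply (@filterlim_opp _ R_NormedModule)].
      eapply filterlim_comp; [exact H2|apply (@filterlim_scal_r _ R_NormedModule (k / c) l2)].
    - apply (@filterlim_plus _ R_NormedModule). }
  assert (Hl : forall a, 0 < a -> filterlim (fun t => exp (a * ln t)) (at_left 1) (locally 1)).
  { intros a Ha. eapply filterlim_filter_le_1; [apply filter_le_within|].
    replace 1 with (exp (a * ln 1)) at 2 by (rewrite ln_1, Rmult_0_r; apply exp_0).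
    apply (@ex_derive_continuous _ R_NormedModule (fun t => exp (a * ln t))).
    auto_derive; lra. }
  (* The primitive is k t^b / b - k (1-t)^c / c, with limits -k / c at 0 and k / b at 1. *)
  exists (fun t => H (exp (b * ln t)) (exp (c * ln (1 - t)))), (H 0 1), (H 1 0).
  split; [|split; [|split]].
  - intros t Ht. unfold H, beta_majorant, plus, opp, scal; simpl; unfold mult; simpl.
    auto_derive; [lra|].
    replace ((b - 1) * ln t) with (b * ln t - ln t) by ring.
    replace ((c - 1) * ln (1 - t)) with (c * ln (1 - t) - ln (1 - t)) by ring.
    unfold Rminus. rewrite !exp_plus, !exp_Ropp, !exp_ln by lra.
    field; lra.
  - intros t Ht. apply (@ex_derive_continuous _ R_NormedModule).
    unfold beta_majorant; auto_derive; lra.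
  - apply HH; [apply _|now apply filterlim_rpower_0|].
    apply (filterlim_comp _ _ _ (fun t => 1 - t) (fun t => exp (c * ln t)) _ (at_left 1));
      [apply filterlim_one_minus_left|now apply Hl].
  - apply HH; [apply _|now apply Hl|].
    apply (filterlim_comp _ _ _ (fun t => 1 - t) (fun t => exp (c * ln t)) _ (at_right 0));
      [apply filterlim_one_minus_right|now apply filterlim_rpower_0].
Qed.

(** On [1/2, 1] one has |ln t| <= ln 2, hence t^a <= 2^|a| for either sign of [a]. *)
Lemma exp_mul_ln_le_half (a t : R) : 1 / 2 <= t <= 1 -> exp (a * ln t) <= exp (Rabs a * ln 2).
Proof.
  intro Ht.
  apply exp_le_mono.
  assert (H1 : ln t <= 0) by (rewrite <- ln_1; apply ln_le; lra).
  assert (H2 : - ln 2 <= ln t) by (rewrite <- ln_Rinv by lra; apply ln_le; lra).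
  pose proof (Rle_abs a); pose proof (Rle_abs (- a)) as H4; rewrite Rabs_Ropp in H4; nra.
Qed.

(* Away from its own singularity each factor is bounded, which turns the product
   of powers into a sum of powers with an elementary primitive. *)
Lemma beta_integrand_le_majorant (b c t : R) : 0 < t < 1 ->
  exp ((b - 1) * ln t + (c - 1) * ln (1 - t))
    <= (exp (Rabs (b - 1) * ln 2) + exp (Rabs (c - 1) * ln 2)) * beta_majorant b c t.
Proof.
  intro Ht; unfold beta_majorant; rewrite exp_plus.
  pose proof (exp_pos ((b - 1) * ln t)) as P1.
  pose proof (exp_pos ((c - 1) * ln (1 - t))) as P2.
  pose proof (exp_pos (Rabs (b - 1) * ln 2)) as P3.
  pose proof (exp_pos (Rabs (c - 1) * ln 2)) as P4.
  destruct (Rle_dec t (1 / 2)) as [H|H].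
  - assert (H1 : exp ((c - 1) * ln (1 - t)) <= exp (Rabs (c - 1) * ln 2))
      by (apply exp_mul_ln_le_half; lra).
    nra.
  - assert (H1 : exp ((b - 1) * ln t) <= exp (Rabs (b - 1) * ln 2))
      by (apply exp_mul_ln_le_half; lra).
    nra.
Qed.

(** * The integrand of the first representation *)

(* At [z = 0] this is the integrand of [Beta_ext]. *)
Definition kernel (p q : R) (x y z : C) (t : R) : C :=
  (Cpower t (x - 1) * Cpower (1 - t) (y - 1) * Cexp (z * t - p / t - q / (1 - t)))%C.

(** With a single exponential, the modulus is read off the real part of the exponent, and equality
    of integrands becomes equality of exponents. *)
Lemma kernel_Cexp (p q : R) (x y z : C) (t : R) : 0 < t < 1 ->
  kernel p q x y z t =
  Cexp ((x - 1) * ln t + (y - 1) * ln (1 - t) + (z * t - p / t - q / (1 - t)))%C.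
Proof.
  intro Ht; unfold kernel.
  rewrite <- RtoC_minus, !Cpower_pos, !Cexp_plus by lra. reflexivity.
Qed.

(** Elementary real and imaginary parts, from which [auto_derive] yields continuity. *)
Lemma kernel_pair (p q : R) (x y z : C) (t : R) : 0 < t < 1 ->
  let A := (Re x - 1) * ln t + (Re y - 1) * ln (1 - t) + (Re z * t - p / t - q / (1 - t)) in
  let B := Im x * ln t + Im y * ln (1 - t) + Im z * t in
  kernel p q x y z t = (exp A * cos B, exp A * sin B).
Proof.
  intros Ht A B. rewrite kernel_Cexp by assumption.
  rewrite <- RtoC_minus, <- !RtoC_div by lra.
  change (exp A * cos B, exp A * sin B) with (Cexp (A, B)); f_equal.
  unfold A, B, Re, Im, Cminus, Cplus, Copp, Cmult, RtoC; simpl; f_equal; ring.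
Qed.

Lemma kernel_continuous (p q : R) (x y z : C) (t : R) : 0 < t < 1 ->
  @continuous _ C_R_NormedModule (kernel p q x y z) t.
Proof.
  intro Ht.
  eapply (@continuous_ext_loc R_UniformSpace C_UniformSpace);
    [|apply (continuous_pair
    (fun t => exp ((Re x - 1) * ln t + (Re y - 1) * ln (1 - t) + (Re z * t - p / t - q / (1 - t)))
            * cos (Im x * ln t + Im y * ln (1 - t) + Im z * t))
    (fun t => exp ((Re x - 1) * ln t + (Re y - 1) * ln (1 - t) + (Re z * t - p / t - q / (1 - t)))
            * sin (Im x * ln t + Im y * ln (1 - t) + Im z * t)));
     apply (@ex_derive_continuous _ R_NormedModule); auto_derive; repeat split; lra].
  apply (locally_interval _ t 0 1); simpl; try lra.
  intros u H0 H1; symmetry; apply kernel_pair; lra.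
Qed.

(** The terms -p/t and -q/(1-t) only lower the real part of the exponent, and Re z * t <= |z|; what
    remains is the modulus of the beta integrand. *)
Lemma kernel_norm_le (p q : R) (x y z : C) (t : R) : 0 <= p -> 0 <= q -> 0 < t < 1 ->
  Cmod (kernel p q x y z t) <=
  exp (Cmod z) * (exp (Rabs (Re x - 1) * ln 2) + exp (Rabs (Re y - 1) * ln 2))
    * beta_majorant (Re x) (Re y) t.
Proof.
  intros Hp Hq Ht.
  rewrite kernel_Cexp, Cmod_Cexp by assumption.
  rewrite Rmult_assoc.
  eapply Rle_trans; [|apply Rmult_le_compat_l;
    [left; apply exp_pos|now apply beta_integrand_le_majorant]].
  rewrite <- exp_plus, <- RtoC_minus, <- !RtoC_div by lra.
  apply exp_le_mono.
  replace (Re _) with ((Re x - 1) * ln t + (Re y - 1) * ln (1 - t) + (Re z * t - p / t - q / (1 - t)))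
    by (unfold Re, Im, Cminus, Cplus, Copp, Cmult, RtoC; simpl; ring).
  assert (0 <= p / t) by (apply Rdiv_le_0_compat; lra).
  assert (0 <= q / (1 - t)) by (apply Rdiv_le_0_compat; lra).
  pose proof (re_le_Cmod z); pose proof (Rle_abs (Re z)); pose proof (Cmod_ge_0 z); nra.
Qed.

Lemma unit_interval_convex (x y t : R) : 0 < x < 1 -> 0 < y < 1 -> x <= t <= y -> 0 < t < 1.
Proof. lra. Qed.

Lemma filter_prod_unit_interval (P : R * R -> Prop) :
  (forall x y, 0 < x < 1 -> 0 < y < 1 -> P (x, y)) -> filter_prod (at_right 0) (at_left 1) P.
Proof.
  exact (Filter_prod _ _ _ _ _ (at_right_interval 0 1 Rlt_0_1) (at_left_interval 0 1 Rlt_0_1)).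
Qed.

(** Separating the ends at 1/2 puts them in order, as the norm inequality for improper integrals
    requires. *)
Lemma filter_prod_unit_interval_le :
  filter_prod (at_right 0) (at_left 1) (fun ab => fst ab <= snd ab).
Proof.
  apply (Filter_prod _ _ _ _ _ (at_right_interval 0 (1 / 2) ltac:(lra))
    (at_left_interval (1 / 2) 1 ltac:(lra))).
  simpl; intros; lra.
Qed.

Lemma kernel_integrable (p q : R) (x y z : C) :
  0 <= p -> 0 <= q -> 0 < Re x -> 0 < Re y ->
  ex_CInt_gen (kernel p q x y z) (at_right 0) (at_left 1).
Proof.
  intros Hp Hq Hx Hy.
  destruct (beta_majorant_integrable (Re x) (Re y) (exp (Cmod z)
      * (exp (Rabs (Re x - 1) * ln 2) + exp (Rabs (Re y - 1) * ln 2))) Hx Hy)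
    as (G & la & lb & HG & Hg & Hla & Hlb).
  eapply (ex_RInt_gen_dominated C_R_CompleteNormedModule (at_right 0) (at_left 1)
    (fun t => 0 < t < 1) (kernel p q x y z) G).
  - apply unit_interval_convex.
  - apply (at_right_interval 0 1 Rlt_0_1).
  - apply (at_left_interval 0 1 Rlt_0_1).
  - apply kernel_continuous.
  - exact HG.
  - exact Hg.
  - intros t Ht. rewrite norm_C_R. now apply kernel_norm_le.
  - exact Hla.
  - exact Hlb.
Qed.

Lemma CInt_gen_correct (Fa Fb : (R -> Prop) -> Prop) {FFa : ProperFilter' Fa}
    {FFb : ProperFilter' Fb} (f : R -> C) :
  ex_CInt_gen f Fa Fb -> @is_RInt_gen C_R_NormedModule f Fa Fb (CInt_gen f Fa Fb).
Proof. now apply (@RInt_gen_correct C_R_CompleteNormedModule). Qed.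

Lemma CInt_gen_unique (Fa Fb : (R -> Prop) -> Prop) {FFa : ProperFilter' Fa}
    {FFb : ProperFilter' Fb} (f : R -> C) (l : C) :
  @is_RInt_gen C_R_NormedModule f Fa Fb l -> CInt_gen f Fa Fb = l.
Proof. now apply (@is_RInt_gen_unique C_R_CompleteNormedModule). Qed.

(** * Termwise integration of the series *)

Lemma Beta_ext_integral (p q : R) (x y : C) :
  0 <= p -> 0 <= q -> 0 < Re x -> 0 < Re y ->
  @is_RInt_gen C_R_NormedModule (kernel p q x y 0) (at_right 0) (at_left 1) (Beta_ext p q x y).
Proof.
  intros Hp Hq Hx Hy. unfold Beta_ext.
  pose proof (CInt_gen_correct _ _ _ (kernel_integrable p q x y 0 Hp Hq Hx Hy)) as H.
  rewrite (CInt_gen_unique _ _ _ (CInt_gen (kernel p q x y 0) (at_right 0) (at_left 1)));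
    [exact H|].
  revert H; apply (is_RInt_gen_ext (V := C_R_NormedModule)).
  apply filter_prod_unit_interval; intros u v Hu Hv t Ht; unfold kernel.
  f_equal; f_equal; ring.
Qed.

Lemma Cexp_mul_nat (n : nat) (w : C) : Cexp (INR n * w) = (Cexp w ^ n)%C.
Proof.
  induction n as [|n IH].
  - simpl. rewrite Cmult_0_l, Cexp_RtoC, exp_0. reflexivity.
  - rewrite S_INR, RtoC_plus, Cmult_plus_distr_r, Cmult_1_l, Cexp_plus, IH, Cpow_S.
    apply Cmult_comm.
Qed.

Lemma kernel_shift (p q : R) (x y z : C) (n : nat) (t : R) : 0 < t < 1 ->
  kernel p q (x + INR n) y z t = (kernel p q x y z t * t ^ n)%C.
Proof.
  intro Ht.
  assert (E : (RtoC t ^ n)%C = Cexp (INR n * ln t)).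
  { rewrite Cexp_mul_nat, Cexp_RtoC, exp_ln by lra. reflexivity. }
  rewrite E, !kernel_Cexp by assumption.
  rewrite <- Cexp_plus. f_equal; ring.
Qed.

(* [Beta x y] times the partial sums of [Phi p q x (x + y) z]. *)
Fixpoint Phi_partial (p q : R) (x y z : C) (n : nat) : C :=
  match n with
  | O => 0
  | S m => Phi_partial p q x y z m + Beta_ext p q (x + INR m) y * (z ^ m / INR (fact m))
  end%C.

(** Here exp(zt) is removed from the kernel by setting its last parameter to 0, and replaced by a
    Taylor polynomial; a finite sum is integrated by linearity. *)
Lemma Phi_partial_integral (p q : R) (x y z : C) (n : nat) :
  0 <= p -> 0 <= q -> 0 < Re x -> 0 < Re y ->
  @is_RInt_gen C_R_NormedModule (fun t => kernel p q x y 0 t * exp_poly n (t * z))%C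
    (at_right 0) (at_left 1) (Phi_partial p q x y z n).
Proof.
  intros Hp Hq Hx Hy.
  induction n as [|n IH].
  - pose proof (is_RInt_gen_Cmult_l _ _ 0 _ _ (Beta_ext_integral p q x y Hp Hq Hx Hy)) as H.
    rewrite Cmult_0_l in H; revert H; apply (is_RInt_gen_ext (V := C_R_NormedModule)).
    apply filter_prod_unit_interval; intros u v _ _ t _.
    rewrite Cmult_0_l; symmetry; apply Cmult_0_r.
  - assert (Hn : 0 < Re (x + INR n)).
    { unfold Re, Cplus, RtoC in *; simpl. pose proof (pos_INR n); lra. }
    eapply (is_RInt_gen_ext (V := C_R_NormedModule)).
    2: { apply (is_RInt_gen_plus (V := C_R_NormedModule)); [exact IH|].
      replace (Beta_ext p q (x + INR n) y * (z ^ n / INR (fact n)))%C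
        with (z ^ n / INR (fact n) * Beta_ext p q (x + INR n) y)%C by apply Cmult_comm.
      exact (is_RInt_gen_Cmult_l _ _ _ _ _ (Beta_ext_integral p q (x + INR n)%C y Hp Hq Hn Hy)). }
    apply filter_prod_unit_interval; simpl fst; simpl snd; intros u v Hu Hv t Ht.
    assert (Ht' : 0 < t < 1)
      by (apply (between_convex _ u v t unit_interval_convex Hu Hv); lra).
    rewrite kernel_shift by assumption.
    change (kernel p q x y 0 t * exp_poly n (t * z)
       + z ^ n / INR (fact n) * (kernel p q x y 0 t * t ^ n)
      = kernel p q x y 0 t * (exp_poly n (t * z) + (t * z) ^ n / INR (fact n)))%C.
    rewrite Cpow_mult_l. unfold Cdiv. ring.
Qed.

(** The integrands differ by the kernel at 0 times a Taylor remainder that is bounded uniformly in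
    [t]. Since [K] is independent of [n], the error inherits the decay of |z|^n / n!. *)
Lemma Phi_partial_error (p q : R) (x y z : C) :
  0 <= p -> 0 <= q -> 0 < Re x -> 0 < Re y ->
  exists K, 0 <= K /\ forall n,
  Cmod (CInt_gen (kernel p q x y z) (at_right 0) (at_left 1) - Phi_partial p q x y z n)
    <= K * (Cmod z ^ n / INR (fact n)).
Proof.
  intros Hp Hq Hx Hy.
  destruct (beta_majorant_integrable (Re x) (Re y)
      (exp (Cmod 0) * (exp (Rabs (Re x - 1) * ln 2) + exp (Rabs (Re y - 1) * ln 2))) Hx Hy)
    as (G & la & lb & HG & Hg & Hla & Hlb).
  set (k := exp (Cmod 0) * _) in *.
  pose proof (is_RInt_gen_derive_on (at_right 0) (at_left 1) (fun t => 0 < t < 1) G _ la lb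
    unit_interval_convex (at_right_interval 0 1 Rlt_0_1) (at_left_interval 0 1 Rlt_0_1) HG Hg Hla Hlb) as HI.
  assert (Hlab : forall n,
    Cmod (CInt_gen (kernel p q x y z) (at_right 0) (at_left 1) - Phi_partial p q x y z n)
    <= exp (Cmod z) * (Cmod z ^ n / INR (fact n)) * (lb - la)).
  { intro n. rewrite <- norm_C_R.
    apply (RInt_gen_norm (V := C_R_CompleteNormedModule) (Fa := at_right 0) (Fb := at_left 1)
      (fun t => kernel p q x y z t - kernel p q x y 0 t * exp_poly n (t * z))%C
      (fun t => exp (Cmod z) * (Cmod z ^ n / INR (fact n)) * (k * beta_majorant (Re x) (Re y) t))).
    - apply filter_prod_unit_interval_le.
    - apply filter_prod_unit_interval; simpl fst; simpl snd; intros u v Hu Hv t Ht'.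
      assert (Ht : 0 < t < 1) by lra. clear Ht'.
      eapply Rle_trans; [right; apply norm_C_R|].
      change (Cmod (kernel p q x y z t - kernel p q x y 0 t * exp_poly n (t * z)) <=
        exp (Cmod z) * (Cmod z ^ n / INR (fact n)) * (k * beta_majorant (Re x) (Re y) t)).
      replace (kernel p q x y z t - kernel p q x y 0 t * exp_poly n (t * z))%C
        with ((Cexp (t * z) - exp_poly n (t * z)) * kernel p q x y 0 t)%C.
      2: { replace (kernel p q x y z t) with (Cexp (t * z) * kernel p q x y 0 t)%C; [ring|].
           rewrite !kernel_Cexp, <- Cexp_plus by assumption. f_equal; ring. }
      rewrite Cmod_mult.
      apply Rmult_le_compat; [apply Cmod_ge_0|apply Cmod_ge_0| |].
      + eapply Rle_trans; [apply Cexp_remainder; lra|].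
        assert (H1 : t ^ n <= 1) by (rewrite <- (pow1 n); apply pow_incr; lra).
        pose proof (exp_pos (Cmod z)); pose proof (pow_le (Cmod z) n (Cmod_ge_0 z)).
        pose proof (INR_fact_lt_0 n) as H3. apply Rinv_0_lt_compat in H3.
        assert (0 <= exp (Cmod z) * Cmod z ^ n * / INR (fact n))
          by (apply Rmult_le_pos; [apply Rmult_le_pos; lra|lra]).
        unfold Rdiv; nra.
      + now apply kernel_norm_le.
    - apply (is_RInt_gen_minus (V := C_R_NormedModule)).
      + exact (CInt_gen_correct _ _ _ (kernel_integrable p q x y z Hp Hq Hx Hy)).
      + now apply Phi_partial_integral.
    - apply (is_RInt_gen_scal (V := R_NormedModule)); exact HI. }
  (* [lb - la] is the integral of the majorant; the absolute value makes the sign of [K]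
     immediate. *)
  exists (exp (Cmod z) * Rabs (lb - la)); split.
  - apply Rmult_le_pos; [left; apply exp_pos|apply Rabs_pos].
  - intro n. eapply Rle_trans; [apply Hlab|].
    rewrite Rmult_assoc, (Rmult_assoc (exp _)), (Rmult_comm (Rabs _)).
    apply Rmult_le_compat_l; [left; apply exp_pos|].
    apply Rmult_le_compat_l; [|apply Rle_abs].
    apply Rdiv_le_0_compat; [apply pow_le, Cmod_ge_0|apply INR_fact_lt_0].
Qed.

Lemma CSeries_unique (a : nat -> C) (l : C) :
  @is_series C_AbsRing C_NormedModule a l -> CSeries a = l.
Proof.
  intro H. apply (@iota_unique C_AbsRing C_CompleteNormedModule); [|exact H].
  intros y Hy. exact (@filterlim_locally_unique _ C_AbsRing C_NormedModule _ _ _ _ _ Hy H).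
Qed.

Lemma Phi_integral (p q : R) (x y z : C) :
  0 <= p -> 0 <= q -> 0 < Re x -> 0 < Re y ->
  Phi p q x (x + y) z =
    (/ Beta x y * CInt_gen (kernel p q x y z) (at_right 0) (at_left 1))%C.
Proof.
  intros Hp Hq Hx Hy. unfold Phi.
  replace (x + y - x)%C with y by ring.
  apply CSeries_unique; unfold is_series.
  (* [sum_n] includes the term of index [n], whereas [Phi_partial] counts terms: hence [S n]. *)
  apply filterlim_ext with (fun n => / Beta x y * Phi_partial p q x y z (S n))%C.
  { intro n; induction n as [|n IH].
    - rewrite sum_O. simpl. unfold Cdiv; ring.
    - rewrite sum_Sn, <- IH.
      change (/ Beta x y * (Phi_partial p q x y z (S n)
          + Beta_ext p q (x + INR (S n)) y * (z ^ S n / INR (fact (S n))))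
       = / Beta x y * Phi_partial p q x y z (S n)
         + Beta_ext p q (x + INR (S n)) y / Beta x y * (z ^ S n / INR (fact (S n))))%C.
      unfold Cdiv; generalize (INR (S n)) (INR (fact (S n))); intros; ring. }
  eapply filterlim_comp; [|apply continuous_Cmult_l].
  refine (proj2 (@filterlim_locally_ball_norm C_AbsRing _ C_NormedModule eventually _
    (fun n => Phi_partial p q x y z (S n)) _) _); intro eps.
  destruct (Phi_partial_error p q x y z Hp Hq Hx Hy) as (K & HK & HE).
  (* Dividing by [K + 1] rather than [K] covers the case K = 0. *)
  destruct (cv_speed_pow_fact (Cmod z) (eps / (K + 1))) as [N HN].
  { apply Rdiv_lt_0_compat; [apply cond_pos|lra]. }
  exists N; intros n Hn. unfold ball_norm.
  change (Cmod (Phi_partial p q x y z (S n)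
     - CInt_gen (kernel p q x y z) (at_right 0) (at_left 1)) < eps).
  rewrite <- Cmod_opp.
  replace (- (Phi_partial p q x y z (S n) - CInt_gen (kernel p q x y z) (at_right 0) (at_left 1)))%C
    with (CInt_gen (kernel p q x y z) (at_right 0) (at_left 1) - Phi_partial p q x y z (S n))%C by ring.
  eapply Rle_lt_trans; [apply HE|].
  specialize (HN (S n) ltac:(lia)). unfold Rdist in HN. rewrite Rminus_0_r in HN.
  pose proof (Rle_abs (Cmod z ^ S n / INR (fact (S n)))) as H1.
  assert (H2 : Cmod z ^ S n / INR (fact (S n)) < eps / (K + 1)) by lra.
  assert (H3 : 0 <= Cmod z ^ S n / INR (fact (S n)))
    by (apply Rdiv_le_0_compat; [apply pow_le, Cmod_ge_0|apply INR_fact_lt_0]).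
  apply Rle_lt_trans with ((K + 1) * (Cmod z ^ S n / INR (fact (S n)))); [nra|].
  replace (pos eps) with ((K + 1) * (eps / (K + 1))) by (field; lra).
  apply Rmult_lt_compat_l; lra.
Qed.

(** * Changes of variable *)

Lemma kernel_integral (p q : R) (x y z : C) :
  0 <= p -> 0 <= q -> 0 < Re x -> 0 < Re y ->
  @is_RInt_gen C_R_NormedModule (kernel p q x y z) (at_right 0) (at_left 1)
    (CInt_gen (kernel p q x y z) (at_right 0) (at_left 1)).
Proof. intros; now apply (CInt_gen_correct _ _ _), kernel_integrable. Qed.

(** A single [is_RInt_gen] fact yields both halves of each representation: convergence, and the
    value by uniqueness. *)
Lemma ex_CInt_gen_and_eq (Fa Fb : (R -> Prop) -> Prop) {FFa : ProperFilter' Fa}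
    {FFb : ProperFilter' Fb} (f : R -> C) (w c l : C) :
  @is_RInt_gen C_R_NormedModule f Fa Fb l -> w = (c * l)%C ->
  ex_CInt_gen f Fa Fb /\ w = (c * CInt_gen f Fa Fb)%C.
Proof.
  intros H ->; split; [now exists l|now rewrite (CInt_gen_unique _ _ _ _ H)].
Qed.

(** Under t = 1 - u, exp(zt) becomes exp(z) exp(-zu). The compensating factor exp(-z) is what later
    turns exp(-z/2) into exp(z/2). *)
Lemma kernel_integral_reflected (p q : R) (x y z : C) :
  0 <= p -> 0 <= q -> 0 < Re x -> 0 < Re y ->
  @is_RInt_gen C_R_NormedModule
    (fun u : R => Cpower u (y - 1) * Cpower (1 - u) (x - 1)
                  * Cexp (- (z * u) - p / (1 - u) - q / u))%C
    (at_right 0) (at_left 1)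
    (Cexp (- z) * CInt_gen (kernel p q x y z) (at_right 0) (at_left 1))%C.
Proof.
  intros Hp Hq Hx Hy.
  pose proof (kernel_integral p q x y z Hp Hq Hx Hy) as H.
  set (I := CInt_gen _ _ _) in *.
  (* The substitution exchanges the ends; the sign from reversing them cancels against the
     derivative -1. *)
  apply (is_RInt_gen_swap (V := C_R_NormedModule) (Fa := at_left 1) (Fb := at_right 0)) in H.
  apply (is_RInt_gen_comp C_R_CompleteNormedModule (at_right 0) (at_left 1) _ _
    (fun t => 0 < t < 1) _ (fun u => 1 - u) (fun _ => -1)) in H.
  2: apply unit_interval_convex.
  2: apply (at_right_interval 0 1 Rlt_0_1).
  2: apply (at_left_interval 0 1 Rlt_0_1).
  2: intros t Ht; apply kernel_continuous; lra.
  2: intros t _; auto_derive; auto; ring.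
  2: intros t _; apply continuous_const.
  2: apply filterlim_one_minus_left.
  2: apply filterlim_one_minus_right.
  apply (is_RInt_gen_Cmult_l _ _ (- Cexp (- z))%C) in H.
  replace (Cexp (- z) * I)%C with (- Cexp (- z) * - I)%C by ring.
  revert H; apply (is_RInt_gen_ext (V := C_R_NormedModule)).
  apply filter_prod_unit_interval; simpl fst; simpl snd; intros u v Hu Hv t Ht.
  apply (fun H => between_convex (fun t => 0 < t < 1) u v t unit_interval_convex Hu Hv
    (conj (Rlt_le _ _ (proj1 H)) (Rlt_le _ _ (proj2 H)))) in Ht.
  rewrite scal_C_R, kernel_Cexp by lra.
  rewrite <- !RtoC_minus. replace (1 - (1 - t)) with t by ring.
  rewrite !Cpower_pos by lra.
  match goal with |- ?u = ?v => change (@eq C u v) end.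
  transitivity (Cexp (- z) * Cexp ((x - 1) * ln (1 - t) + (y - 1) * ln t
    + (z * (1 - t)%R - p / (1 - t)%R - q / t)))%C; [ring|].
  rewrite <- !Cexp_plus; f_equal.
  rewrite !RtoC_minus. field.
  split; [|rewrite <- RtoC_minus]; apply RtoC_neq_0; lra.
Qed.

(** With t = (u - a) / (b - a), the two powers and dt contribute (b-a) to the exponents -(x-1),
    -(y-1) and -1, that is -(x+y-1) in all; this power is moved to the side of the value. *)
Lemma kernel_integral_interval (p q a b : R) (x y z : C) :
  0 <= p -> 0 <= q -> 0 < Re x -> 0 < Re y -> a < b ->
  @is_RInt_gen C_R_NormedModule
    (fun u : R => Cpower (u - a) (x - 1) * Cpower (b - u) (y - 1)
      * Cexp (z * (u - a) / (b - a) - p * (b - a) / (u - a) - q * (b - a) / (b - u)))%C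
    (at_right a) (at_left b)
    (Cpower (b - a) (x + y - 1) * CInt_gen (kernel p q x y z) (at_right 0) (at_left 1))%C.
Proof.
  intros Hp Hq Hx Hy Hab.
  pose proof (kernel_integral p q x y z Hp Hq Hx Hy) as H.
  set (I := CInt_gen _ _ _) in *.
  set (phi := fun u => (u - a) / (b - a)).
  assert (Hphi : forall u, is_derive phi u (/ (b - a))).
  { intro u; unfold phi; auto_derive; [lra|field; lra]. }
  assert (Hpc : forall u, continuous phi u).
  { intro u; apply (@ex_derive_continuous _ R_NormedModule); eexists; apply Hphi. }
  assert (P1 : forall u, a < u -> 0 < phi u) by (intros u Hu; apply Rdiv_lt_0_compat; lra).
  assert (Q1 : forall u, 1 - phi u = (b - u) / (b - a)) by (intro u; unfold phi; field; lra).
  assert (P2 : forall u, u < b -> phi u < 1).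
  { intros u Hu. assert (0 < (b - u) / (b - a)) by (apply Rdiv_lt_0_compat; lra).
    rewrite <- Q1 in *; lra. }
  assert (HD : forall x y t, a < x < b -> a < y < b -> x <= t <= y -> a < t < b) by (intros; lra).
  apply (is_RInt_gen_comp C_R_CompleteNormedModule (at_right a) (at_left b) _ _
    (fun t => a < t < b) _ phi (fun _ => / (b - a))) in H.
  2: exact HD.
  2: now apply at_right_interval.
  2: now apply at_left_interval.
  2: intros t Ht; apply kernel_continuous; split; [apply P1|apply P2]; lra.
  2: intros t _; apply Hphi.
  2: intros t _; apply continuous_const.
  2: { replace 0 with (phi a) by (unfold phi; field; lra).
       apply filterlim_within_continuous; [apply Hpc|].
       replace (phi a) with 0 by (unfold phi; field; lra); exact P1. }
  2: { replace 1 with (phi b) by (unfold phi; field; lra).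
       apply filterlim_within_continuous; [apply Hpc|].
       replace (phi b) with 1 by (unfold phi; field; lra); exact P2. }
  apply (is_RInt_gen_Cmult_l _ _ (Cpower (b - a) (x + y - 1))) in H.
  revert H; apply (is_RInt_gen_ext (V := C_R_NormedModule)).
  apply (Filter_prod _ _ _ _ _ (at_right_interval a b Hab) (at_left_interval a b Hab)).
  simpl fst; simpl snd; intros u v Hu Hv t Ht.
  apply (fun H => between_convex (fun t => a < t < b) u v t HD Hu Hv
    (conj (Rlt_le _ _ (proj1 H)) (Rlt_le _ _ (proj2 H)))) in Ht.
  rewrite scal_C_R, kernel_Cexp by (split; [apply P1|apply P2]; lra).
  rewrite <- !RtoC_minus, Q1.
  unfold phi. rewrite !ln_div by lra.
  (* The Jacobian is also written as an exponential, so that only exponents are left to compare. *)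
  rewrite (RtoC_Cexp_ln (/ (b - a))) by (apply Rinv_0_lt_compat; lra).
  rewrite ln_Rinv by lra.
  rewrite !Cpower_pos by lra.
  rewrite <- !Cexp_plus; f_equal.
  rewrite !RtoC_div, RtoC_opp by lra.
  set (L1 := ln (t - a)); set (L2 := ln (b - t)); set (L3 := ln (b - a)).
  assert (N1 : RtoC (t - a) <> 0) by (apply RtoC_neq_0; lra).
  assert (N2 : RtoC (b - t) <> 0) by (apply RtoC_neq_0; lra).
  assert (N3 : RtoC (b - a) <> 0) by (apply RtoC_neq_0; lra).
  rewrite (RtoC_minus L1), (RtoC_minus L2).
  field; auto.
Qed.

(** With t = u / (1 + u), one has 1 - t = 1 / (1 + u) and dt = (1 + u)^(-2) du; the exponents of 1 +
    u add up to -(x-1) - (y-1) - 2 = -(x+y). *)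
Lemma kernel_integral_half_line (p q : R) (x y z : C) :
  0 <= p -> 0 <= q -> 0 < Re x -> 0 < Re y ->
  @is_RInt_gen C_R_NormedModule
    (fun u : R => Cpower u (x - 1) * Cpower (1 + u) (- (x + y))
      * Cexp (z * u / (1 + u) - p * (1 + u) / u - q * (1 + u)))%C
    (at_right 0) (Rbar_locally p_infty)
    (CInt_gen (kernel p q x y z) (at_right 0) (at_left 1)).
Proof.
  intros Hp Hq Hx Hy.
  pose proof (kernel_integral p q x y z Hp Hq Hx Hy) as H.
  set (I := CInt_gen _ _ _) in *.
  set (phi := fun u => u / (1 + u)).
  assert (Hphi : forall u, 0 <= u -> is_derive phi u (/ (1 + u) ^ 2)).
  { intros u Hu; unfold phi; auto_derive; [lra|field; lra]. }
  assert (P1 : forall u, 0 < u -> 0 < phi u) by (intros u Hu; apply Rdiv_lt_0_compat; lra).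
  assert (Q1 : forall u, 0 < u -> 1 - phi u = / (1 + u)) by (intros u Hu; unfold phi; field; lra).
  assert (P2 : forall u, 0 < u -> phi u < 1).
  { intros u Hu. assert (0 < / (1 + u)) by (apply Rinv_0_lt_compat; lra).
    rewrite <- Q1 in *; lra. }
  assert (HD : forall x y t, 0 < x -> 0 < y -> x <= t <= y -> 0 < t) by (intros; lra).
  assert (F1 : at_right 0 (fun u => 0 < u)).
  { generalize (at_right_interval 0 1 Rlt_0_1); apply filter_imp; tauto. }
  assert (F2 : Rbar_locally p_infty (fun u => 0 < u)) by (exists 0; auto).
  apply (is_RInt_gen_comp C_R_CompleteNormedModule (at_right 0) (Rbar_locally p_infty) _ _
    (fun t => 0 < t) _ phi (fun u => / (1 + u) ^ 2)) in H.
  2: exact HD.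
  2: exact F1.
  2: exact F2.
  2: intros t Ht; apply kernel_continuous; auto.
  2: intros t Ht; apply Hphi; lra.
  2: { intros t Ht; apply (@ex_derive_continuous _ R_NormedModule); auto_derive.
       apply Rgt_not_eq; nra. }
  2: { replace 0 with (phi 0) at 2 by (unfold phi; field).
       apply filterlim_within_continuous.
       - apply (@ex_derive_continuous _ R_NormedModule); eexists; apply Hphi; lra.
       - replace (phi 0) with 0 by (unfold phi; field); exact P1. }
  (* 1 - phi u = 1 / (1 + u) is below eps once u > 1 / eps. *)
  2: { intros P [eps HP]. exists (/ eps). intros u Hu.
       pose proof (cond_pos eps) as He. pose proof (Rinv_0_lt_compat _ He) as He'.
       apply HP; [|apply P2; lra].
       change (Rabs (phi u - 1) < eps).
       rewrite Rabs_minus_sym, Q1 by lra.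
       rewrite Rabs_pos_eq by (left; apply Rinv_0_lt_compat; lra).
       rewrite <- (Rinv_inv eps). apply Rinv_lt_contravar; [|lra].
       apply Rmult_lt_0_compat; lra. }
  revert H; apply (is_RInt_gen_ext (V := C_R_NormedModule)).
  apply (Filter_prod _ _ _ _ _ F1 F2).
  simpl fst; simpl snd; intros u v Hu Hv t Ht.
  apply (fun H => between_convex (fun t => 0 < t) u v t HD Hu Hv
    (conj (Rlt_le _ _ (proj1 H)) (Rlt_le _ _ (proj2 H)))) in Ht.
  rewrite scal_C_R, kernel_Cexp by auto.
  rewrite <- !RtoC_minus, Q1 by lra.
  assert (Ht2 : 0 < (1 + t) ^ 2) by (apply pow_lt; lra).
  unfold phi. rewrite ln_div by lra.
  rewrite (RtoC_Cexp_ln (/ (1 + t) ^ 2)) by now apply Rinv_0_lt_compat.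
  rewrite !ln_Rinv by lra.
  replace ((1 + t) ^ 2) with ((1 + t) * (1 + t)) by ring.
  rewrite ln_mult by lra.
  rewrite <- RtoC_plus, !Cpower_pos by lra.
  rewrite <- !Cexp_plus; f_equal.
  rewrite RtoC_div, RtoC_inv by lra.
  set (L1 := ln t); set (L2 := ln (1 + t)).
  assert (N1 : RtoC t <> 0) by (apply RtoC_neq_0; lra).
  assert (N2 : RtoC (1 + t) <> 0) by (apply RtoC_neq_0; lra).
  rewrite !RtoC_opp, (RtoC_plus L2), (RtoC_minus L1).
  field; auto.
Qed.

(** * The five integral representations *)

Theorem theorem2p1 :
  forall (p q : R) (lambda rho z : C),
  0 <= p -> 0 <= q ->
  - (1 / 2) < Re rho ->
  - (1 / 2) < Re (rho + lambda)%C ->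
  - (1 / 2) < Re (rho - lambda)%C ->
  ~ (Im z = 0 /\ Re z <= 0) ->
  (* (1) *)
  (let f := fun t : R =>
     (Cpower t (rho - lambda - 1 / 2) * Cpower (1 - t) (rho + lambda - 1 / 2)
        * Cexp (z * t - p / t - q / (1 - t)))%C in
   ex_CInt_gen f (at_right 0) (at_left 1) /\
   Whittaker p q lambda rho z =
     (Cpower z (rho + 1 / 2) * Cexp (- (z / 2))
        / Beta (rho - lambda + 1 / 2) (rho + lambda + 1 / 2)
        * CInt_gen f (at_right 0) (at_left 1))%C) /\
  (* (2) *)
  (let f := fun u : R =>
     (Cpower u (rho + lambda - 1 / 2) * Cpower (1 - u) (rho - lambda - 1 / 2)
        * Cexp (- (z * u) - p / (1 - u) - q / u))%C in
   ex_CInt_gen f (at_right 0) (at_left 1) /\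
   Whittaker p q lambda rho z =
     (Cpower z (rho + 1 / 2) * Cexp (z / 2)
        / Beta (rho - lambda + 1 / 2) (rho + lambda + 1 / 2)
        * CInt_gen f (at_right 0) (at_left 1))%C) /\
  (* (3) *)
  (forall a b : R, a < b ->
   let f := fun u : R =>
     (Cpower (u - a) (rho - lambda - 1 / 2)
        * Cpower (b - u) (rho + lambda - 1 / 2)
        * Cexp (z * (u - a) / (b - a) - p * (b - a) / (u - a)
                - q * (b - a) / (b - u)))%C in
   ex_CInt_gen f (at_right a) (at_left b) /\
   Whittaker p q lambda rho z =
     (Cpower (b - a) (- (2 * rho)) * Cpower z (rho + 1 / 2) * Cexp (- (z / 2))
        / Beta (rho - lambda + 1 / 2) (rho + lambda + 1 / 2)
        * CInt_gen f (at_right a) (at_left b))%C) /\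
  (* (4) *)
  (let f := fun u : R =>
     (Cpower u (rho - lambda - 1 / 2) * Cpower (1 + u) (- (2 * rho + 1))
        * Cexp (z * u / (1 + u) - p * (1 + u) / u - q * (1 + u)))%C in
   ex_CInt_gen f (at_right 0) (Rbar_locally p_infty) /\
   Whittaker p q lambda rho z =
     (Cpower z (rho + 1 / 2) * Cexp (- (z / 2))
        / Beta (rho - lambda + 1 / 2) (rho + lambda + 1 / 2)
        * CInt_gen f (at_right 0) (Rbar_locally p_infty))%C) /\
  (* (5) *)
  (let f := fun u : R =>
     (Cpower (1 + u) (rho - lambda - 1 / 2)
        * Cpower (1 - u) (rho + lambda - 1 / 2)
        * Cexp (z * (u + 1) / 2 - 2 * p / (1 + u) - 2 * q / (1 - u)))%C in
   ex_CInt_gen f (at_right (-1)) (at_left 1) /\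
   Whittaker p q lambda rho z =
     (Cpower 2 (- (2 * rho)) * Cpower z (rho + 1 / 2) * Cexp (- (z / 2))
        / Beta (rho - lambda + 1 / 2) (rho + lambda + 1 / 2)
        * CInt_gen f (at_right (-1)) (at_left 1))%C).
Proof.
  intros p q lambda rho z Hp Hq _ Hplus Hminus _.
  set (x := (rho - lambda + 1 / 2)%C); set (y := (rho + lambda + 1 / 2)%C).
  assert (Hx : 0 < Re x).
  { replace (Re x) with (Re (rho - lambda) + 1 / 2)
      by (unfold x, Re, Cminus, Cplus, Cdiv, Cmult, Cinv, RtoC; simpl; field). lra. }
  assert (Hy : 0 < Re y).
  { replace (Re y) with (Re (rho + lambda) + 1 / 2)
      by (unfold y, Re, Cminus, Cplus, Cdiv, Cmult, Cinv, RtoC; simpl; field). lra. }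
  assert (H2 : RtoC 2 <> 0) by (apply RtoC_neq_0; lra).
  replace (rho - lambda - 1 / 2)%C with (x - 1)%C by (unfold x; field; exact H2).
  replace (rho + lambda - 1 / 2)%C with (y - 1)%C by (unfold y; field; exact H2).
  assert (E : (2 * rho + 1 = x + y)%C) by (unfold x, y; field; exact H2).
  unfold Whittaker; fold x; rewrite E, Phi_integral by assumption.
  set (I := CInt_gen (kernel p q x y z) (at_right 0) (at_left 1)).
  (* As x + y - 1 = 2 rho, the prefactor of (3) cancels the power produced by rescaling the
     interval. *)
  assert (Epow : forall r : R, 0 < r -> (Cpower r (- (2 * rho)) * Cpower r (x + y - 1) = 1)%C).
  { intros r Hr. rewrite !Cpower_pos, <- Cexp_plus, <- E by assumption.
    replace (_ + _)%C with (RtoC 0) by ring. now rewrite Cexp_RtoC, exp_0. }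
  assert (Hint : forall a b : R, a < b ->
    let f := fun u : R =>
      (Cpower (u - a) (x - 1) * Cpower (b - u) (y - 1)
        * Cexp (z * (u - a) / (b - a) - p * (b - a) / (u - a) - q * (b - a) / (b - u)))%C in
    ex_CInt_gen f (at_right a) (at_left b) /\
    (Cpower z (rho + 1 / 2) * Cexp (- (z / 2)) * (/ Beta x y * I))%C =
      (Cpower (b - a) (- (2 * rho)) * Cpower z (rho + 1 / 2) * Cexp (- (z / 2)) / Beta x y
         * CInt_gen f (at_right a) (at_left b))%C).
  { intros a b Hab f. apply (ex_CInt_gen_and_eq _ _ f _ _ (Cpower (b - a) (x + y - 1) * I)%C).
    - now apply kernel_integral_interval.
    - specialize (Epow (b - a) ltac:(lra)); rewrite RtoC_minus in Epow.
      transitivity (Cpower (b - a) (- (2 * rho)) * Cpower (b - a) (x + y - 1)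
        * (Cpower z (rho + 1 / 2) * Cexp (- (z / 2)) * (/ Beta x y * I)))%C;
        [rewrite Epow|unfold Cdiv]; ring. }
  split; [|split; [|split; [|split]]].
  - apply (ex_CInt_gen_and_eq _ _ _ _ _ I); [|unfold Cdiv; ring].
    now apply kernel_integral.
  - apply (ex_CInt_gen_and_eq _ _ _ _ _ (Cexp (- z) * I)%C).
    + now apply kernel_integral_reflected.
    + replace (- (z / 2))%C with (z / 2 + - z)%C by (field; exact H2).
      rewrite Cexp_plus; unfold Cdiv; ring.
  - exact Hint.
  - apply (ex_CInt_gen_and_eq _ _ _ _ _ I); [|unfold Cdiv; ring].
    now apply kernel_integral_half_line.
  (* (5) is (3) on [-1, 1], where b - a = 2 and u - a = 1 + u. *)
  - destruct (Hint (-1) 1 ltac:(lra)) as [Hex Heq].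
    assert (E2 : (1 - -1 = 2)%C) by (rewrite <- RtoC_minus; f_equal; ring).
    rewrite E2 in Heq.
    rewrite Heq. eapply (ex_CInt_gen_and_eq _ _ _); [|reflexivity].
    generalize (CInt_gen_correct _ _ _ Hex); rewrite E2; apply (is_RInt_gen_ext (V := C_R_NormedModule)).
    apply (Filter_prod _ _ _ _ _ (at_right_interval (-1) 1 ltac:(lra))
      (at_left_interval (-1) 1 ltac:(lra))).
    intros u v _ _ t _.
    replace (t - -1)%C with (1 + t)%C by (rewrite <- RtoC_minus, <- RtoC_plus; f_equal; ring).
    f_equal; f_equal; unfold Cdiv; ring.
Qed.
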